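(* Let $G\in\mathcal{G}$, with cliques on $X=\{x_1,\ldots,x_m\}$ and $Y=\{y_1,\ldots,y_n\}$, where $n\geq m+3$, such that $\{x_1,y_1\}$, $\{x_2,y_2\}$, $\{x_3,y_3\}$ are edges of $G$ and at most $n-m$ vertices of $Y$ have a neighbour in $X$. Then $T_2(G)$ is not well-covered.
   Context: $\mathcal{G}$ is the class of graphs obtained by taking the disjoint union of a complete graph $K_m$ with vertex set $X=\{x_1,\ldots,x_m\}$ and a complete graph $K_n$ with vertex set $Y=\{y_1,\ldots,y_n\}$, where $n\geq m$, and then adding some (possibly no) edges each joining a vertex of $X$ to a vertex of $Y$. The $2$-token graph $T_2(G)$ has as vertices the $2$-subsets of $V(G)$, two of them adjacent if their symmetric difference is an edge of $G$. A graph is well-covered if all of its maximal (with respect to inclusion) independent sets have the same cardinality. *)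

(* Defs.v *)
From mathcomp Require Import all_boot.

Set Implicit Arguments.
Unset Strict Implicit.
Unset Printing Implicit Defensive.

Record sgraph := SGraph {
  vertex :> finType;
  edge : rel vertex;
  edge_sym : symmetric edge;
  edge_irr : irreflexive edge }.

Definition independent (G : sgraph) (S : {set G}) : bool :=
  [forall u in S, forall v in S, ~~ edge u v].

Definition well_covered (G : sgraph) : Prop :=
  forall A B : {set G},
    maxset (@independent G) A -> maxset (@independent G) B -> #|A| = #|B|.

Section TokenGraph.
Variables (k : nat) (G : sgraph).

Definition token_vertex := {A : {set G} | #|A| == k}.

Definition symdiff (A B : {set G}) : {set G} := (A :\: B) :|: (B :\: A).

Definition token_edge : rel token_vertex := fun A B =>
  [exists u : G, exists v : G,
     edge u v && (symdiff (val A) (val B) == [set u; v])].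

Lemma token_edge_sym : symmetric token_edge.
Proof.
move=> A B; rewrite /token_edge.
by apply: eq_existsb => u; apply: eq_existsb => v; rewrite /symdiff setUC.
Qed.

Lemma token_edge_irr : irreflexive token_edge.
Proof.
move=> A; apply/negbTE/existsP => -[u /existsP[v /andP[_ /eqP]]].
by rewrite /symdiff setDv setU0 => /setP/(_ u); rewrite !inE eqxx.
Qed.

Definition token_graph : sgraph := SGraph token_edge_sym token_edge_irr.

End TokenGraph.

(* [two_clique_graph x y] says that G belongs to the class, as witnessed by
   the enumerations x of X and y of Y.  Indices start at 0, so the i-th
   vertices x_i, y_i (i >= 1) are [x] and [y] at the ordinal of value i - 1.
   Edges between X and Y are unconstrained. *)
Record two_clique_graph (G : sgraph) (m n : nat)
    (x : 'I_m -> G) (y : 'I_n -> G) : Prop := TwoCliqueGraph {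
  tcg_le : m <= n;
  tcg_x_inj : injective x;
  tcg_y_inj : injective y;
  tcg_disjoint : forall i j, x i <> y j;
  tcg_cover : forall v : G, (exists i, v = x i) \/ (exists j, v = y j);
  tcg_x_clique : forall i i', i <> i' -> edge (x i) (x i');
  tcg_y_clique : forall j j', j <> j' -> edge (y j) (y j') }.

(* Main.v *)
(* An independent set of the 2-token graph consists of a matching inside X, a
   matching inside Y, and a partial injection from X to Y (pairs {x, y}).  Let Z
   be the set of vertices of Y without neighbours in X; the hypothesis gives
   |Z| >= m.

   Injecting X into Z creates no conflict with matchings of X, Y :\: Z and Z; at
   most one vertex of each of these three sets stays unmatched, so twice the size
   is at least 2m + (m + n - 3).

   Using instead {x1, y2}, {x2, y3}, {x3, y1} and an injection of the remaining
   X into Z, the pairs inside {x1, x2, x3} and inside {y1, y2, y3} are blocked.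
   Matching the rest of X and the rest of Y up to at most one vertex each leaves,
   in every extension, two unmatched vertices on each side, so twice the size of
   an extension is at most 2m + (m - 2) + (n - 2).

   Both families are described by an involution p of G preserving X, whose
   2-cycles are the pairs inside X and inside Y, and a map f from X to Y.
   Counting ordered pairs, i.e. twice the size, avoids any parity discussion. *)
Require Import Defs.
From mathcomp Require Import all_boot zify.

Set Implicit Arguments.
Unset Strict Implicit.
Unset Printing Implicit Defensive.

(** * Injections and fibrewise pairings on finite types *)

Lemma exists_injection_in (T : finType) (A B : {set T}) :
  #|A| <= #|B| ->
  exists f : T -> T, {in A, forall v, f v \in B} /\ {in A &, injective f}.
Proof.
move=> leAB; pose f v := nth v (enum B) (index v (enum A)).
have ltB v : v \in A -> index v (enum A) < size (enum B).
  by rewrite -mem_enum -index_mem -!cardE => /leq_trans->.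
exists f; split=> [v vA | u v uA vA].
  by rewrite -mem_enum mem_nth ?ltB.
rewrite /f (set_nth_default v) ?ltB // => /eqP.
rewrite nth_uniq ?enum_uniq ?ltB // => /eqP eqi.
by rewrite -(nth_index v (s := enum A) (x := u)) ?mem_enum // eqi nth_index ?mem_enum.
Qed.

(** Enumerate each fibre of [c] and swap positions 2k and 2k+1; only the last position of a fibre of
    odd size has no partner. *)
Lemma exists_fiberwise_pairing (T : finType) (K : eqType) (c : T -> K) :
  exists p : T -> T, [/\ involutive p, forall v, c (p v) = c v,
    forall v w, p v = v -> p w = w -> c v = c w -> v = w
  & forall v, p v = v -> odd #|[set w | c w == c v]|].
Proof.
pose F v := enum [set w | c w == c v].
pose flip i := if odd i then i.-1 else i.+1.
have flipK i : flip (flip i) = i by rewrite /flip; case: ifP; case: ifP; lia.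
have flip_neq i : flip i != i by rewrite /flip; case: ifP; lia.
have memF u v : (u \in F v) = (c u == c v) by rewrite mem_enum inE.
have Fv v : index v (F v) < size (F v) by rewrite index_mem memF.
have uF v : uniq (F v) by apply: enum_uniq.
(* The default value [v] makes a last element without partner a fixed point. *)
pose p v := nth v (F v) (flip (index v (F v))).
have cp v : c (p v) = c v.
  rewrite /p; case: (ltnP (flip (index v (F v))) (size (F v))) => h.
    by apply/eqP; rewrite -memF mem_nth.
  by rewrite nth_default.
have Fp v : F (p v) = F v by rewrite /F cp.
have fixE v : p v = v -> size (F v) <= flip (index v (F v)).
  move=> pv; rewrite leqNgt; apply/negP=> h.
  have := flip_neq (index v (F v)); rewrite -(nth_uniq v h (Fv v)) //.
  by rewrite nth_index ?memF // -[X in X == _]/(p v) pv eqxx.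
have fix_last v : p v = v ->
    ~~ odd (index v (F v)) /\ size (F v) = (index v (F v)).+1.
  by move=> /fixE; have := Fv v; rewrite /flip; case: ifP; lia.
exists p; split=> // [v | v w pv pw cvw | v pv].
- case: (ltnP (flip (index v (F v))) (size (F v))) => h; last first.
    by rewrite {2}/p nth_default // /p nth_default.
  have ip : index (p v) (F v) = flip (index v (F v)) by rewrite index_uniq.
  by rewrite {1}/p Fp ip flipK (set_nth_default v) // nth_index ?memF.
- have FE : F v = F w by rewrite /F cvw.
  have [_ sv] := fix_last _ pv; have [_ sw] := fix_last _ pw.
  rewrite -(nth_index v (s := F v) (x := v)) ?memF //.
  rewrite -(nth_index v (s := F w) (x := w)) ?memF // FE; congr nth.
  by move: sv sw; rewrite FE; lia.
- by rewrite cardE -/(F v); case: (fix_last _ pv) => ? ->; rewrite oddS.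
Qed.

(** * Sets of 2-tokens as symmetric irreflexive relations *)

Section TokenPairs.
Variable G : sgraph.
Implicit Types (S T : {set token_graph 2 G}) (R : rel G).

Definition paired S : rel G := fun a b => [exists A in S, val A == [set a; b]].

Definition tokens_of R : {set token_graph 2 G} :=
  [set A | [exists a, exists b, R a b && (val A == [set a; b])]].

Lemma pairedP S a b :
  reflect (exists2 A, A \in S & val A = [set a; b]) (paired S a b).
Proof.
by apply: (iffP exists_inP) => -[A AS /eqP E]; exists A => //; apply/eqP.
Qed.

Lemma paired_sym S : symmetric (paired S).
Proof. by move=> a b; rewrite /paired setUC. Qed.

Lemma paired_irr S : irreflexive (paired S).
Proof.
move=> a; apply/negbTE/negP=> /pairedP[A _ E].
by have := eqP (valP A); rewrite E setUid cards1.
Qed.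

Lemma pairedW S T a b : S \subset T -> paired S a b -> paired T a b.
Proof. by move=> /subsetP sST /pairedP[A /sST AT E]; apply/pairedP; exists A. Qed.

Lemma set2_inj (a b c d : G) : [set a; b] = [set c; d] ->
  (a = c /\ b = d) \/ (a = d /\ b = c).
Proof.
move/setP=> E; move: (E a) (E b) (E c) (E d); rewrite !inE !eqxx ?orbT /=.
by do 4![case: eqP => ? //=]; subst; auto; rewrite ?eqxx ?orbT;
  do ?[case: eqP => ? //=]; subst; auto.
Qed.

Lemma paired_tokens_of R : symmetric R -> irreflexive R ->
  paired (tokens_of R) =2 R.
Proof.
move=> symR irrR a b; apply/pairedP/idP => [[A] | Rab].
  rewrite inE => /existsP[c /existsP[d /andP[Rcd /eqP->]]].
  by case/set2_inj=> -[<- <-] //; rewrite symR.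
have neq : a != b by apply: contraTneq Rab => ->; rewrite irrR.
have cA : #|[set a; b]| == 2 by rewrite cards2 neq.
exists (Sub [set a; b] cA : token_vertex 2 G) => //; rewrite inE.
by apply/existsP; exists a; apply/existsP; exists b; rewrite Rab /=.
Qed.

Lemma card_paired S : #|[set ab | paired S ab.1 ab.2]| = #|S|.*2.
Proof.
pose P (A : token_graph 2 G) := [set ab : G * G | val A == [set ab.1; ab.2]].
have cP A : #|P A| = 2.
  have /cards2P[u [v [nuv E]]] := valP A.
  rewrite (_ : P A = [set (u, v); (v, u)]) ?cards2 ?xpair_eqE ?negb_and ?nuv //.
  apply/setP=> -[a b]; rewrite !inE /= !xpair_eqE E.
  apply/eqP/orP => [/set2_inj | ].
    by case=> -[-> ->]; rewrite !eqxx; [left | right].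
  by case=> /andP[/eqP-> /eqP->] //; rewrite setUC.
(* Extended by the empty set outside [S], so that the disjoint union runs over all tokens. *)
pose F A := if A \in S then P A else set0.
have -> : [set ab | paired S ab.1 ab.2] = \bigcup_A F A.
  apply/setP=> -[a b]; rewrite inE /=; apply/pairedP/bigcupP => -[A].
    by move=> AS E; exists A; rewrite // /F AS inE; apply/eqP.
  by move=> _; rewrite /F; case: ifP => AS; rewrite inE // => /eqP; exists A.
rewrite -sum1_card partition_disjoint_bigcup => [|A B nAB].
  rewrite -muln2 -sum_nat_const [RHS]big_mkcond; apply: eq_bigr => A _.
  by rewrite sum1_card /F; case: ifP => _; rewrite ?cP ?cards0.
rewrite -setI_eq0; apply/eqP/setP=> ab; rewrite /F in_setI.
case: ifP => _; case: ifP => _; rewrite !inE ?andbF //.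
by apply: contra_neqF nAB => /andP[/eqP EA /eqP]; rewrite -EA => /val_inj.
Qed.

(** Two tokens are adjacent exactly when they share one vertex and their other vertices are joined
    by an edge. *)
Lemma independent_pairedP S :
  reflect (forall a u v, paired S a u -> paired S a v -> ~~ edge u v)
          (independent S).
Proof.
apply: (iffP idP) => [indS a u v au av | H].
  have nau : a != u by apply: contraTneq au => ->; rewrite paired_irr.
  have nav : a != v by apply: contraTneq av => ->; rewrite paired_irr.
  case/pairedP: au => A AS EA; case/pairedP: av => B BS EB.
  have /forall_inP/(_ _ AS)/forall_inP/(_ _ BS) := indS.
  apply: contra => euv; apply/existsP; exists u; apply/existsP; exists v.
  rewrite euv EA EB /=; apply/eqP/setP=> w; rewrite !inE.
  have nuv : u != v by apply: contraTneq euv => ->; rewrite edge_irr.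
  have [->|nwa] := eqVneq w a; first by rewrite (negbTE nau) (negbTE nav).
  by have [->|nwu] := eqVneq w u; rewrite ?(negbTE nuv) /= ?andbT ?andbF ?orbF.
apply/forall_inP=> A AS; apply/forall_inP=> B BS; apply/negP.
case/existsP=> u /existsP[v /andP[euv /eqP D]].
have nuv : u != v by apply: contraTneq euv => ->; rewrite edge_irr.
(* Two 2-sets whose symmetric difference has two elements share one vertex [a] and have one private
   vertex each. *)
have cA := cardsID (val B) (val A); have cB := cardsID (val A) (val B).
have cD : #|symdiff (val A) (val B)| = 2 by rewrite D cards2 nuv.
rewrite setIC (eqP (valP B)) in cB; rewrite (eqP (valP A)) in cA.
have dAB : [disjoint val A :\: val B & val B :\: val A].
  rewrite -setI_eq0; apply/eqP/setP=> w.
  by rewrite !inE; case: (w \in val A); rewrite ?andbF.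
have := (leq_card_setU (val A :\: val B) (val B :\: val A)).2.
rewrite dAB cD => /eqP {}cD.
have /cards1P[a Ea] : #|val A :&: val B| == 1 by lia.
have /cards1P[u' Eu] : #|val A :\: val B| == 1 by lia.
have /cards1P[v' Ev] : #|val B :\: val A| == 1 by lia.
have EA : val A = [set a; u'] by rewrite -(setID (val A) (val B)) Ea Eu.
have EB : val B = [set a; v'].
  by rewrite -(setID (val B) (val A)) [_ :&: _]setIC Ea Ev.
suff euv' : edge u' v'.
  by have := H a u' v'; rewrite euv' => H'; apply/negP: isT; apply: H';
    apply/pairedP; [exists A | exists B].
by move: D; rewrite /symdiff Eu Ev => /set2_inj[] [-> ->]; rewrite // edge_sym.
Qed.

End TokenPairs.

(** * Independent sets built from an involution and an injection *)

Section TwoCliques.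
Variables (G : sgraph) (X : {set G}).
Implicit Types (T : {set token_graph 2 G}) (K L : {set G}).

Definition clique K := {in K &, forall u v, u != v -> edge u v}.

Definition pairing_rel (p f : G -> G) : rel G := fun a b =>
  [|| (p a != a) && (b == p a), (a \in X) && (b == f a)
    | (b \in X) && (a == f b)].

Section Construction.
Variables p f : G -> G.
Hypotheses (pK : involutive p) (pX : forall v, (p v \in X) = (v \in X)).
Hypotheses (fX : {in X, forall v, f v \notin X}) (f_inj : {in X &, injective f}).

Lemma pairing_rel_sym : symmetric (pairing_rel p f).
Proof.
suff H a b : pairing_rel p f a b -> pairing_rel p f b a.
  by move=> a b; apply/idP/idP; apply: H.
rewrite /pairing_rel => /or3P[/andP[pa /eqP->] | -> | ->]; last by rewrite orbT.
  by rewrite pK eqxx eq_sym pa.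
by rewrite !orbT.
Qed.

Lemma pairing_rel_irr : irreflexive (pairing_rel p f).
Proof.
move=> a; rewrite /pairing_rel [a == p a]eq_sym andNb /= orbb.
by apply/negP=> /andP[aX /eqP E]; have := fX aX; rewrite -E aX.
Qed.

Let S := tokens_of (pairing_rel p f).

Lemma paired_pairing : paired S =2 pairing_rel p f.
Proof. exact: paired_tokens_of pairing_rel_sym pairing_rel_irr. Qed.

(** Two 2-cycles of [p] through one vertex coincide, and so do two pairs of [f]. Conflicts can only
    arise between a 2-cycle and a pair of [f], meeting at [a] in [X] or at [f a]. *)
Lemma independent_pairing :
  {in X, forall a, p a != a -> ~~ edge (p a) (f a)} ->
  {in X, forall a, p (f a) != f a -> ~~ edge a (p (f a))} ->
  independent S.
Proof.
move=> I1 I2; apply/independent_pairedP => a u v; rewrite !paired_pairing.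
case/or3P=> [/andP[pa /eqP->] | /andP[aX /eqP->] | /andP[uX /eqP Eu]];
case/or3P=> [/andP[pa' /eqP->] | /andP[aX' /eqP->] | /andP[vX /eqP Ev]];
  rewrite ?edge_irr //.
- exact: I1.
- by rewrite edge_sym Ev; apply: I2; rewrite -?Ev.
- by rewrite edge_sym; apply: I1.
- by have := fX vX; rewrite -Ev aX.
- by rewrite Eu; apply: I2; rewrite -?Eu.
- by have := fX uX; rewrite -Eu aX'.
- by rewrite (f_inj uX vX) ?edge_irr // -Eu.
Qed.

(** The ordered pairs [(a, p a)] stay on one side, [(a, f a)] leave [X] and [(f a, a)] enter it, so
    the three families are disjoint. *)
Lemma card_pairing : #|[set v | p v != v]| + #|X|.*2 <= #|S|.*2.
Proof.
pose E1 := [set (a, p a) | a in [set v | p v != v]].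
pose E2 := [set (a, f a) | a in X].
pose E3 := [set (f a, a) | a in X].
have c1 : #|E1| = #|[set v | p v != v]| by apply: card_imset => a b [].
have c2 : #|E2| = #|X| by apply: card_imset => a b [].
have c3 : #|E3| = #|X| by apply: card_imset => a b [].
have d23 : [disjoint E2 & E3].
  rewrite -setI_eq0; apply/eqP/setP=> ab; rewrite !inE.
  apply/negP=> /andP[/imsetP[a aX ->] /imsetP[b bX [E _]]].
  by have := fX bX; rewrite -E aX.
have d1 : [disjoint E1 & E2 :|: E3].
  rewrite -setI_eq0; apply/eqP/setP=> ab; rewrite !inE.
  apply/negP=> /andP[/imsetP[a _ ->] /orP[]/imsetP[b bX [Ea Ep]]].
    by have := fX bX; rewrite -Ep pX Ea bX.
  by have := fX bX; rewrite -Ea -pX Ep bX.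
have := (leq_card_setU E2 E3).2; rewrite d23 => /eqP c23.
have := (leq_card_setU E1 (E2 :|: E3)).2; rewrite d1 => /eqP c123.
rewrite -card_paired -addnn -{1}c2 -c3 -c23 -c1 -c123; apply/subset_leq_card/subsetP.
move=> ab /setUP[/imsetP[a] | /setUP[]/imsetP[a]]; rewrite !inE paired_pairing /=.
- by move=> pa ->; rewrite /pairing_rel pa eqxx.
- by move=> aX ->; rewrite /pairing_rel aX eqxx orbT.
- by move=> aX ->; rewrite /pairing_rel aX eqxx !orbT.
Qed.

End Construction.

(** * Upper bounds for independent sets of tokens *)

Definition matched T K L := [set a in K | [exists b in L, paired T a b]].

(** Two partners of one vertex in the clique [L] would be adjacent, so the first projection is
    injective on these pairs. *)
Lemma card_paired_clique T K L : independent T -> clique L ->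
  #|[set ab | paired T ab.1 ab.2 & (ab.1 \in K) && (ab.2 \in L)]|
    <= #|matched T K L|.
Proof.
move=> /independent_pairedP indT clL; set P := [set ab | _].
rewrite -(card_in_imset (f := fst) (D := P)) => [|[a b] [a' b']].
  apply/subset_leq_card/subsetP=> c /imsetP[[a b]]; rewrite inE /=.
  move=> /and3P[ab aK bL] ->; rewrite inE aK.
  by apply/exists_inP; exists b.
rewrite !inE /= => /and3P[ab _ bL] /and3P[ab' _ bL'] Ea; subst a'.
congr pair; apply/eqP; apply: contraNT (indT _ _ _ ab ab') => nbb.
exact: clL.
Qed.

(** Split the ordered pairs by the sides of their ends; a vertex of [X] has at most one partner
    outside [X], and reversal handles the opposite direction. *)
Lemma card_tokens_le T : independent T -> clique X -> clique (~: X) ->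
  #|T|.*2 <= #|matched T X X| + #|matched T (~: X) (~: X)| + #|X|.*2.
Proof.
move=> indT clX clY; rewrite -card_paired.
pose P K L := [set ab | paired T ab.1 ab.2 & (ab.1 \in K) && (ab.2 \in L)].
have XX : #|P X X| <= _ := card_paired_clique X indT clX.
have YY : #|P (~: X) (~: X)| <= _ := card_paired_clique (~: X) indT clY.
have XY : #|P X (~: X)| <= _ := card_paired_clique X indT clY.
have mX : #|matched T X (~: X)| <= #|X|.
  by apply/subset_leq_card/subsetP=> a; rewrite inE => /andP[].
have YX : #|P (~: X) X| <= #|P X (~: X)|.
  rewrite -(card_imset (f := fun ab => (ab.2, ab.1))) => [|[a b] [c d] [-> ->] //].
  apply/subset_leq_card/subsetP=> c /imsetP[[a b]]; rewrite inE /=.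
  by move=> /and3P[ab aY bX] ->; rewrite inE /= paired_sym ab aY bX.
have sub : [set ab | paired T ab.1 ab.2] \subset
    (P X X :|: P (~: X) (~: X)) :|: (P X (~: X) :|: P (~: X) X).
  apply/subsetP=> -[a b]; rewrite !inE /= => ->.
  by case: (a \in X); case: (b \in X).
have := subset_leq_card sub.
have := (leq_card_setU (P X X :|: P (~: X) (~: X)) (P X (~: X) :|: P (~: X) X)).1.
have := (leq_card_setU (P X X) (P (~: X) (~: X))).1.
have := (leq_card_setU (P X (~: X)) (P (~: X) X)).1.
by lia.
Qed.

(* A matched vertex of D has its partner outside D, and that partner must be
   the fixed point of p, so at most one vertex of D is matched inside K. *)
Lemma card_matched_le T K (D : {set G}) (p : G -> G) :
  independent T -> clique K -> D \subset K -> #|D| = 3 ->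
  {in D &, forall u v, ~~ paired T u v} ->
  {in K :\: D, forall u, p u \in K :\: D} ->
  {in K :\: D, forall u, p u != u -> paired T u (p u)} ->
  {in K :\: D &, forall u v, p u = u -> p v = v -> u = v} ->
  #|matched T K K| + 2 <= #|K|.
Proof.
move=> /independent_pairedP indT clK sDK cD nD pKD pT fixp.
have partner u v : u \in D -> v \in K -> paired T u v -> v \in K :\: D /\ p v = v.
  move=> uD vK uv; have vD : v \in K :\: D.
    by rewrite inE vK andbT; apply: contraL uv => vD; apply: nD.
  (* If [p] moved [v], the tokens [{v, u}] and [{v, p v}] would share [v], with [u] and [p v]
     adjacent in [K]. *)
  split=> //; apply/eqP; apply: contraT => pv.
  rewrite paired_sym in uv; have := indT _ _ _ uv (pT v vD pv).
  have := pKD v vD; rewrite inE => /andP[pvD pvK].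
  by rewrite clK ?(subsetP sDK u) //; apply: contraNneq pvD => <-.
have m1 : #|matched T K K :&: D| <= 1.
  apply/card_le1_eqP=> u v; rewrite !inE.
  move=> /andP[/andP[uK /exists_inP[u' u'K uu']] uD].
  move=> /andP[/andP[vK /exists_inP[v' v'K vv']] vD].
  have [u'D pu'] := partner _ _ uD u'K uu'; have [v'D pv'] := partner _ _ vD v'K vv'.
  have E := fixp _ _ u'D v'D pu' pv'; subst v'.
  rewrite paired_sym in uu'; rewrite paired_sym in vv'.
  by apply/eqP; apply: contraNT (indT _ _ _ uu' vv') => nuv; rewrite clK // eq_sym.
have m2 : #|matched T K K :\: D| <= #|K :\: D|.
  by apply/subset_leq_card/setSD/subsetP=> u; rewrite inE => /andP[].
have := cardsID D (matched T K K); have := cardsID D K.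
by rewrite (setIidPr sDK) cD; lia.
Qed.

End TwoCliques.

(** * Two maximal independent sets of different sizes *)

Section Main.
Variables (G : sgraph) (X : {set G}) (x1 x2 x3 y1 y2 y3 : G).

Let Z := [set v | (v \notin X) && [forall u in X, ~~ edge u v]].

Lemma two_clique_token_not_well_covered :
  clique X -> clique (~: X) -> #|X| <= #|Z| ->
  [/\ x1 \in X, x2 \in X & x3 \in X] ->
  [/\ y1 \notin X, y2 \notin X & y3 \notin X] ->
  uniq [:: x1; x2; x3] -> uniq [:: y1; y2; y3] ->
  [/\ edge x1 y1, edge x2 y2 & edge x3 y3] ->
  ~ well_covered (token_graph 2 G).
Proof.
move=> clX clY leXZ [x1X x2X x3X] [y1X y2X y3X] ux uy [e1 e2 e3] wc.
have [f [fZ f_inj]] := exists_injection_in leXZ.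
have ZX v : v \in Z -> v \notin X by rewrite inE => /andP[].
have Zedge u v : v \in Z -> u \in X -> ~~ edge u v.
  by rewrite inE => /andP[_ /forall_inP]; apply.
have fX : {in X, forall v, f v \notin X} by move=> v /fZ/ZX.
have [A [maxA cA]] : exists A : {set token_graph 2 G},
    maxset (@independent _) A /\ #|X|.*2 + (#|X| + #|~: X|) <= #|A|.*2 + 3.
  (* The three fibres are [X], [Z] and the rest of Y, each with at most one fixed point of [p]. *)
  pose c v := if v \in X then None else Some (v \in Z).
  have [p [pK cp fixp _]] := exists_fiberwise_pairing c.
  have pX v : (p v \in X) = (v \in X) by have := cp v; rewrite /c; do 2!case: ifP.
  have pZ v : v \in Z -> p v \in Z.
    move=> vZ; have := cp v; rewrite /c pX (negbTE (ZX _ vZ)) vZ.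
    by case=> ->.
  have indS : independent (tokens_of (pairing_rel X p f)).
    (* Both conditions exclude edges between [X] and [Z]. *)
    apply: independent_pairing => // a aX _.
      by apply: Zedge; rewrite ?pX ?fZ.
    by apply: Zedge => //; apply/pZ/fZ.
  have [A maxA sSA] := maxset_exists indS.
  exists A; split=> //; have := subset_leq_card sSA.
  have := card_pairing pK pX fX.
  have : #|[set v | p v == v]| <= 3.
    have <- : #|{: option bool}| = 3 by rewrite card_option card_bool.
    apply: (leq_card_in c) => u v; rewrite !inE => /eqP pu /eqP pv.
    exact: fixp.
  have : #|[set v | p v == v]| + #|[set v | p v != v]| = #|X| + #|~: X|.
    rewrite cardsC -(cardsC [set v | p v == v]); congr (_ + #|pred_of_set _|).
    by apply/setP=> v; rewrite !inE.
  by clear; lia.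
have [B [maxB cB]] : exists B : {set token_graph 2 G},
    maxset (@independent _) B /\ #|B|.*2 + 4 <= #|X|.*2 + (#|X| + #|~: X|).
  pose DX := [set x1; x2; x3]; pose DY := [set y1; y2; y3].
  have DXX : DX \subset X by rewrite !subUset !sub1set x1X x2X.
  have DYY : DY \subset ~: X by rewrite !subUset !sub1set !inE y1X y2X.
  have DXE v : v \in X -> (v \in DX :|: DY) = (v \in DX).
    move=> vX; rewrite inE orbC; case: (boolP (v \in DY)) => // /(subsetP DYY).
    by rewrite inE vX.
  have DYE v : v \notin X -> (v \in DX :|: DY) = (v \in DY).
    move=> vX; rewrite inE; case: (boolP (v \in DX)) => // /(subsetP DXX).
    by rewrite (negbTE vX).
  have DYZ v : v \in Z -> v \notin DY.
    move=> vZ; apply/negP; rewrite !inE -orbA => /or3P[]/eqP E; subst v.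
    - by have := Zedge _ _ vZ x1X; rewrite e1.
    - by have := Zedge _ _ vZ x2X; rewrite e2.
    - by have := Zedge _ _ vZ x3X; rewrite e3.
  (* An even subset of Z containing [f v] for every [v] in [X :\: DX]. *)
  pose C := [set v in Z | odd #|Z| ==> (v != f x1)].
  have CZ v : v \in C -> v \in Z by rewrite inE => /andP[].
  have evenC : ~~ odd #|C|.
    case oZ : (odd #|Z|); last first.
      rewrite (_ : C = Z) ?oZ //; by apply/setP=> v; rewrite [v \in C]inE oZ andbT.
    have EC : Z :\ f x1 = C.
      by apply/setP=> v; rewrite [v \in C]inE oZ /= in_setD1 andbC.
    by move: oZ; rewrite (cardsD1 (f x1)) fZ // EC add1n oddS.
  (* Dropping [f x1] is harmless: [f] is injective on [X], and [x1] will be sent elsewhere. *)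
  have fC v : v \in X -> v \notin DX -> f v \in C.
    move=> vX vD; rewrite inE fZ //=; apply/implyP=> _.
    by apply: contra vD => /eqP/f_inj-> //; rewrite !inE eqxx.
  (* Each of the six special vertices gets a colour of its own, hence is fixed by [p]. Separating
     [C] from the rest of Y keeps partners of [f v] free of neighbours in [X]. *)
  pose c v : G + nat := if v \in DX :|: DY then inl v else
    inr (if v \in X then 0 else if v \in C then 1 else 2).
  have [p [pK cp fixp oddp]] := exists_fiberwise_pairing c.
  have pD v : v \in DX :|: DY -> p v = v.
    move=> vD; have := cp v; rewrite /c vD.
    by case: ifP => // _ [].
  have pnD v : v \notin DX :|: DY -> p v \notin DX :|: DY.
    by move=> vD; have := cp v; rewrite /c (negbTE vD); case: ifP.
  have pX v : (p v \in X) = (v \in X).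
    have [vD|vD] := boolP (v \in DX :|: DY); first by rewrite pD.
    have := cp v; rewrite /c (negbTE vD) (negbTE (pnD _ vD)).
    by case: ifP => _; case: ifP => _ //; case: ifP.
  have CD v : v \in C -> v \notin DX :|: DY.
    by move=> /CZ vZ; rewrite DYE ?ZX // DYZ.
  have cC v : (c v == inr 1) = (v \in C).
    rewrite /c; case: ifP => vD.
      by apply/esym/negP=> /CD; rewrite vD.
    case: ifP => vX; last by case: ifP.
    by apply/esym/negP=> /CZ/ZX; rewrite vX.
  have pC v : v \in C -> p v \in C by rewrite -!cC cp.
  (* Evenness of [C] leaves only one colour class of Y outside [DY] that can contain a fixed
     point. *)
  have nfixC v : v \in C -> p v != v.
    move=> vC; apply: contra evenC => /eqP/oddp.
    have -> // : [set w | c w == c v] = C.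
    by apply/setP=> w; rewrite inE; move: vC; rewrite -!cC => /eqP->.
  (* The cyclic shift makes the edges [x1 y1], [x2 y2], [x3 y3] block every token inside [DX] or
     [DY]. *)
  pose g v := if v == x1 then y2 else if v == x2 then y3
              else if v == x3 then y1 else f v.
  move: (ux) (uy); rewrite /= !inE !negb_or.
  move=> /and3P[/andP[n12 n13] n23 _] /and3P[/andP[m12 m13] m23 _].
  have g1 : g x1 = y2 by rewrite /g eqxx.
  have g2 : g x2 = y3 by rewrite /g eq_sym (negbTE n12) eqxx.
  have g3 : g x3 = y1 by rewrite /g eq_sym (negbTE n13) eq_sym (negbTE n23) eqxx.
  have gE v : v \notin DX -> g v = f v.
    rewrite !inE !negb_or -andbA => /and3P[h1 h2 h3].
    by rewrite /g (negbTE h1) (negbTE h2) (negbTE h3).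
  have gD v : v \in DX -> g v \in DY.
    by rewrite !inE -orbA => /or3P[]/eqP->; rewrite ?g1 ?g2 ?g3 eqxx ?orbT.
  have gX : {in X, forall v, g v \notin X}.
    move=> v vX; case: (boolP (v \in DX)) => [/gD/(subsetP DYY) | /gE->].
      by rewrite inE.
    exact: fX.
  have g_inj : {in X &, injective g}.
    move=> u v uX vX; have [uD | uD] := boolP (u \in DX); last first.
      have [/gD vD | vD] := boolP (v \in DX); last by rewrite !gE //; apply: f_inj.
      rewrite gE // => E; move: vD; rewrite -E => vD.
      by have := DYZ _ (fZ _ uX); rewrite vD.
    have [vD | vD] := boolP (v \in DX); last first.
      rewrite (gE v) // => E; have := gD _ uD; rewrite E => vD'.
      by have := DYZ _ (fZ _ vX); rewrite vD'.
    move: uD vD; rewrite !inE -!orbA => /or3P[]/eqP-> /or3P[]/eqP-> //;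
      rewrite ?g1 ?g2 ?g3 => E; first [by rewrite E eqxx in m12
        | by rewrite E eqxx in m13 | by rewrite E eqxx in m23].
  have pairedS := paired_pairing pK gX.
  have indS : independent (tokens_of (pairing_rel X p g)).
    (* Since [p] fixes [DX] and [DY], only [a] outside [DX] matters; there [g a = f a] lies in [C],
       which [p] preserves. *)
    apply: independent_pairing => // a aX pa.
      have aD : a \notin DX.
        by apply: contra pa => aD; apply/eqP/pD; rewrite DXE.
      by apply: Zedge; rewrite ?pX // gE // fZ.
    have aD : a \notin DX.
      apply: contra pa => /gD aD; apply/eqP/pD.
      by rewrite inE aD orbT.
    by apply: Zedge => //; rewrite gE //; apply/CZ/pC/fC.
  have [B maxB sSB] := maxset_exists indS.
  exists B; split=> //.
  have indB : independent B by have /maxsetp := maxB.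
  have /independent_pairedP nB := indB.
  have Bf v : v \in X -> paired B v (g v).
    by move=> vX; apply: (pairedW sSB); rewrite pairedS /pairing_rel vX eqxx orbT.
  have Bp v : p v != v -> paired B v (p v).
    by move=> pv; apply: (pairedW sSB); rewrite pairedS /pairing_rel pv eqxx.
  have n1 : paired B x1 y2 by rewrite -g1 Bf.
  have n2 : paired B x2 y3 by rewrite -g2 Bf.
  have n3 : paired B x3 y1 by rewrite -g3 Bf.
  (* A token inside [DX] or [DY] shares a vertex with one of these three cross tokens, and the
     remaining ends form an edge [x_i y_i]. *)
  have X12 : ~~ paired B x1 x2.
    by apply/negP=> h; have := nB _ _ _ h n1; rewrite e2.
  have X23 : ~~ paired B x2 x3.
    by apply/negP=> h; have := nB _ _ _ h n2; rewrite e3.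
  have X31 : ~~ paired B x3 x1.
    by apply/negP=> h; have := nB _ _ _ h n3; rewrite e1.
  rewrite paired_sym in n1; rewrite paired_sym in n2; rewrite paired_sym in n3.
  have Y21 : ~~ paired B y2 y1.
    by apply/negP=> h; have := nB _ _ _ n1 h; rewrite e1.
  have Y32 : ~~ paired B y3 y2.
    by apply/negP=> h; have := nB _ _ _ n2 h; rewrite e2.
  have Y13 : ~~ paired B y1 y3.
    by apply/negP=> h; have := nB _ _ _ n3 h; rewrite e3.
  have cX : #|matched B X X| + 2 <= #|X|.
    apply: (card_matched_le (D := DX) (p := p)) => //.
    - by rewrite -[RHS](card_uniqP ux); apply: eq_card => v; rewrite !inE orbA.
    - move=> u v; rewrite !inE -!orbA => /or3P[]/eqP-> /or3P[]/eqP->;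
        by rewrite ?paired_irr // paired_sym.
    - move=> v /setDP[vX]; rewrite -DXE // => /pnD.
      by rewrite DXE ?pX // => pvD; rewrite in_setD pvD pX.
    - by move=> v _; apply: Bp.
    - move=> u v /setDP[uX uD] /setDP[vX vD] pu pv; apply: fixp => //.
      by rewrite /c !DXE // (negbTE uD) (negbTE vD) uX vX.
  have cY : #|matched B (~: X) (~: X)| + 2 <= #|~: X|.
    apply: (card_matched_le (D := DY) (p := p)) => //.
    - by rewrite -[RHS](card_uniqP uy); apply: eq_card => v; rewrite !inE orbA.
    - move=> u v; rewrite !inE -!orbA => /or3P[]/eqP-> /or3P[]/eqP->;
        by rewrite ?paired_irr // paired_sym.
    - move=> v /setDP[]; rewrite inE => vX; rewrite -DYE // => /pnD.
      by rewrite DYE ?pX // => pvD; rewrite in_setD pvD in_setC pX.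
    - by move=> v _; apply: Bp.
    - move=> u v /setDP[]; rewrite inE => uX uD.
      move=> /setDP[]; rewrite inE => vX vD pu pv; apply: fixp => //.
      rewrite /c !DYE // (negbTE uD) (negbTE vD) (negbTE uX) (negbTE vX).
      (* Fixed points avoid [C], so [u] and [v] both have colour 2. *)
      have -> : (u \in C) = false by apply: contraTF (eqxx u) => /nfixC; rewrite pu.
      by have -> : (v \in C) = false by apply: contraTF (eqxx v) => /nfixC; rewrite pv.
  have lin (a b s t k : nat) : s + 2 <= a -> t + 2 <= b ->
      k <= s + t + a.*2 -> k + 4 <= a.*2 + (a + b) by clear; lia.
  exact: lin cX cY (card_tokens_le indB clX clY).
(* Equal sizes would put 3|X| + |Y| - 3 below 3|X| + |Y| - 4. *)
move: (wc A B maxA maxB) cA cB.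
by clear; lia.
Qed.

End Main.

(** * Transfer to the enumerated cliques *)

Theorem theorem6p8 (G : sgraph) (m n : nat) (x : 'I_m -> G) (y : 'I_n -> G)
    (hG : two_clique_graph x y)
    (hm : 3 <= m)
    (hn : m + 3 <= n)
    (hedges : forall (i : 'I_m) (j : 'I_n),
        (i : nat) = (j : nat) -> (i : nat) < 3 -> edge (x i) (y j))
    (hY : #|[set j : 'I_n | [exists i : 'I_m, edge (x i) (y j)]]| <= n - m) :
  ~ well_covered (token_graph 2 G).
Proof.
have [_ xI yI dxy cov xcl ycl] := hG.
pose X := [set x i | i in 'I_m].
have xX i : x i \in X by apply: imset_f.
have yX j : y j \notin X.
  by apply/negP=> /imsetP[i _ E]; case: (dxy i j).
have YP v : v \notin X -> exists j, v = y j.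
  by case: (cov v) => // -[i ->]; rewrite xX.
have hn3 : 3 <= n by lia.
pose i_ k (lt : k < 3) : 'I_m := Ordinal (leq_trans lt hm).
pose j_ k (lt : k < 3) : 'I_n := Ordinal (leq_trans lt hn3).
have l0 : 0 < 3 by []. have l1 : 1 < 3 by []. have l2 : 2 < 3 by [].
apply: (@two_clique_token_not_well_covered G X
  (x (i_ _ l0)) (x (i_ _ l1)) (x (i_ _ l2))
  (y (j_ _ l0)) (y (j_ _ l1)) (y (j_ _ l2))); try by split.
- move=> _ _ /imsetP[i _ ->] /imsetP[i' _ ->] nii; apply: xcl => E.
  by rewrite E eqxx in nii.
- move=> u v; rewrite !inE => /YP[j ->] /YP[j' ->] njj; apply: ycl => E.
  by rewrite E eqxx in njj.
(* At least n - (n - m) = m vertices of Y have no neighbour in [X]. *)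
- rewrite [#|X|]card_imset // card_ord.
  set J := [set j | _] in hY.
  have sub : y @: (~: J) \subset
      [set v | (v \notin X) && [forall u in X, ~~ edge u v]].
    apply/subsetP=> _ /imsetP[j jJ ->]; rewrite inE yX /=.
    apply/forall_inP=> _ /imsetP[i _ ->]; move: jJ; rewrite !inE negb_exists.
    by move/forallP.
  have := subset_leq_card sub; rewrite card_imset //.
  by have := cardsC J; rewrite card_ord; lia.
- by rewrite /= !inE !(inj_eq xI).
- by rewrite /= !inE !(inj_eq yI).
- by split; apply: hedges.
Qed.
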